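(* Let $p^s$ (seen domain $D^s$) and $p^u$ (unseen domain $D^u$) be joint distributions of a face image $X$ and its label $Y\in\{\text{live},\text{spoof}\}$, let $\mathcal{G}$ be the class of encoders under consideration, and let $G_\theta\in\mathcal{G}$ be an encoder with representation $T=G_\theta(X)$. Let $I^s(T;Y)$ be the mutual information between $T$ and $Y$ under the seen domain and $I^u(T;Y_{live})$ the mutual information between $T$ and the live label under the unseen domain. Let $\Gamma(G_\theta\mid Y_{live})$ be the domain gap between live samples and let $\Psi(\delta)=\Psi(\delta\mid Y_{live})$ be the supremum discrepancy of mutual information at gap level $\delta$. Then $$I^{u}(T;Y_{live})\;\geq\; I^{s}(T;Y)-\Psi\big(\Gamma(G_{\theta}\mid Y_{live})\big).$$
   Context: An encoder $G$ is a (measurable) map from images to a feature space. Its representation is $T=G(X)$. The seen domain $D^s$ and unseen domain $D^u$ each give a joint distribution of $(X,Y)$, denoted $p^s$ and $p^u$, with $Y\in\{\text{live},\text{spoof}\}$. The superscripts $s,u$ on mutual information indicate the domain whose distribution is used. $Y_{live}$ denotes the live label: as an argument of mutual information it is the random variable indicating whether the sample is live, and conditioning on $Y_{live}$ means conditioning on the sample being live, which is assumed to have positive probability in both domains. Let $D(\cdot\|\cdot)$ be a fixed divergence between probability distributions (for instance the Kullback–Leibler divergence), with values in $[0,\infty]$. Domain gap between live samples: for an encoder $G$ with $T=G(X)$, $$\Gamma(G\mid Y_{live})=D\big(p^{u}(T\mid Y_{live})\,\big\|\,p^{s}(T\mid Y_{live})\big).$$ Supremum discrepancy: for $\delta\in[0,\infty]$,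 $$\Psi(\delta\mid Y_{live})=\sup\big\{\,\big|I^{s}(Y;T)-I^{u}(Y_{live};T)\big| \;:\; G\in\mathcal{G},\ T=G(X),\ \Gamma(G\mid Y_{live})\leq\delta\,\big\},$$ so that $\Psi$ is a non-decreasing function of $\delta$. The theorem abbreviates $\Psi(\delta\mid Y_{live})$ to $\Psi(\delta)$. *)

(* Defs.v *)
From HB Require Import structures.
From mathcomp Require Import all_boot all_order all_algebra.
From mathcomp Require Import all_classical all_reals all_analysis.

Set Implicit Arguments.
Unset Strict Implicit.
Unset Printing Implicit Defensive.

Import Order.TTheory GRing.Theory Num.Theory.
Import numFieldNormedType.Exports.

Local Open Scope classical_set_scope.
Local Open Scope ring_scope.
Local Open Scope charge_scope.
Local Open Scope ereal_scope.

Section joint_variable.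
Context {d d1 d2 : measure_display} {Omega : measurableType d}
  {A : measurableType d1} {B : measurableType d2}.
Variables (U : {mfun Omega >-> A}) (V : {mfun Omega >-> B}).

Definition joint (w : Omega) : A * B := (U w, V w).

Let measurable_joint : measurable_fun [set: Omega] joint.
Proof. by apply/measurable_fun_pair => /=; exact: measurable_funPT. Qed.

HB.instance Definition _ := isMeasurableFun.Build _ _ _ _ joint measurable_joint.

End joint_variable.

Section information.
Context {R : realType}.

(* Kullback-Leibler divergence, in nats. The value of [ln] at [0] is
   irrelevant: the density is positive [P]-almost everywhere. *)
Definition KL {d : measure_display} {S : measurableType d}
    (P Q : probability S R) : \bar R :=
  if `[< P `<< Q >] then
    \int[P]_x (ln (fine (('d (charge_of_finite_measure P) '/d Q) x)))%:E
  else +oo.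

Definition mutual_info {d d1 d2 : measure_display} {Omega : measurableType d}
    {A : measurableType d1} {B : measurableType d2} (P : probability Omega R)
    (U : {mfun Omega >-> A}) (V : {mfun Omega >-> B}) : \bar R :=
  KL (distribution P (joint U V)) (distribution P U \x distribution P V).

(* The conditional probability P(. | E). If [P E = 0], [mnormalize] falls back
   on its second argument, so that the value is then junk. *)
Definition cond_prob {d : measure_display} {Omega : measurableType d}
    (P : probability Omega R) (E : set Omega) (mE : measurable E) :
    probability Omega R :=
  mnormalize (mrestr P mE) P.

(* Only what is common to all usual divergences is required. Two [probability]
   structures represent the same law as soon as they agree on measurable sets,
   even if they are not Leibniz-equal. *)
Definition divergence {d : measure_display} {S : measurableType d}
    (D : probability S R -> probability S R -> \bar R) : Prop :=
  (forall P Q, 0 <= D P Q) /\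
  (forall P Q : probability S R,
     (forall E, measurable E -> P E = Q E) -> D P Q = 0).

End information.

Definition live : bool := true.
Definition spoof : bool := false.

Section variables_of_a_domain.
Context {dX dF : measure_display} (X : measurableType dX) {F : measurableType dF}.

Definition Y (w : X * bool) : bool := w.2.

Let measurable_Y : measurable_fun [set: X * bool] Y.
Proof. exact: measurable_snd. Qed.

HB.instance Definition _ := isMeasurableFun.Build _ _ _ _ Y measurable_Y.

Definition Ylive (w : X * bool) : bool := Y w == live.

Let measurable_Ylive : measurable_fun [set: X * bool] Ylive.
Proof.
exact: (measurableT_comp (f := fun b : bool => b == live) _ measurable_Y).
Qed.

HB.instance Definition _ :=
  isMeasurableFun.Build _ _ _ _ Ylive measurable_Ylive.

Definition live_event : set (X * bool) := [set w | Y w = live].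

Lemma measurable_live_event : measurable live_event.
Proof. by rewrite -[live_event]setTI; exact: measurable_Y measurableT [set live] I. Qed.

Definition rep (G : {mfun X >-> F}) (w : X * bool) : F := G w.1.

Let measurable_rep G : measurable_fun [set: X * bool] (rep G).
Proof.
apply: (measurableT_comp (measurable_funPT G)); exact: measurable_fst.
Qed.

HB.instance Definition _ G :=
  isMeasurableFun.Build _ _ _ _ (rep G) (measurable_rep G).

End variables_of_a_domain.
Arguments Y {dX X}.
Arguments Ylive {dX X}.
Arguments live_event {dX X}.
Arguments measurable_live_event {dX X}.

Section domain_gap.
Context {R : realType} {dX dF : measure_display}
  {X : measurableType dX} {F : measurableType dF}.

Definition live_law (p : probability (X * bool)%type R) (G : {mfun X >-> F}) :
    probability F R :=
  distribution (cond_prob p measurable_live_event) (rep G).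

Variables (D : probability F R -> probability F R -> \bar R)
  (ps pu : probability (X * bool)%type R).

Definition Gamma (G : {mfun X >-> F}) : \bar R :=
  D (live_law pu G) (live_law ps G).

Definition Psi (Enc : set {mfun X >-> F}) (delta : \bar R) : \bar R :=
  ereal_sup [set `|mutual_info ps Y (rep G) - mutual_info pu Ylive (rep G)|
            | G in [set G | Enc G /\ Gamma G <= delta]].

End domain_gap.

(* Main.v *)
From HB Require Import structures.
Require Import Defs.
From mathcomp Require Import all_boot all_order all_algebra.
From mathcomp Require Import all_classical all_reals all_analysis.
From mathcomp Require Import measurable_realfun.

Import Order.TTheory GRing.Theory Num.Theory.

Local Open Scope classical_set_scope.
Local Open Scope ring_scope.
Local Open Scope ereal_scope.

(* The supremum defining [Psi] at level [Gamma G] is taken over a set that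
   contains [G] itself, so [Psi] bounds the discrepancy of [G] and the
   inequality is a rearrangement of this bound. The bound concerns [I(Y; T)]
   whereas the inequality concerns [I(T; Y)]: they agree because relative
   entropy is invariant under the measurable isomorphism that exchanges the
   two components of a pair. *)

Section change_of_law.
Context {R : realType} {d d' : measure_display}
  {S : measurableType d} {S' : measurableType d'}.

(* Unlike [integral_pushforward], integrability is not assumed: positive and
   negative parts are transported separately. *)
Lemma integral_image_law {mu : {measure set S -> \bar R}}
    {nu : {measure set S' -> \bar R}} {f : {mfun S >-> S'}} (D : set S')
    (h : S' -> \bar R) :
  (forall E, measurable E -> nu E = mu (f @^-1` E)) ->
  measurable D -> measurable_fun [set: S'] h ->
  \int[nu]_(y in D) h y = \int[mu]_(x in f @^-1` D) (h \o f) x.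
Proof.
move=> nuE mD mh.
rewrite (eq_measure_integral (pushforward mu f)); last first.
  by move=> E mE _; exact: nuE.
rewrite integralE [RHS]integralE (funepos_comp h f) (funeneg_comp h f).
congr (_ - _); rewrite (ge0_integral_pushforward (phi := f))//.
- exact/measurable_funepos/measurable_funTS.
- exact/measurable_funeneg/measurable_funTS.
Qed.

Lemma dominates_image_law {P Q : probability S R} {P' Q' : probability S' R}
    {f : {mfun S >-> S'}} :
  (forall E, measurable E -> P' E = P (f @^-1` E)) ->
  (forall E, measurable E -> Q' E = Q (f @^-1` E)) ->
  P `<< Q -> P' `<< Q'.
Proof.
move=> P'E Q'E /null_content_dominatesP PQ.
apply/null_content_dominatesP => E mE Q'0; rewrite P'E//.
apply: PQ; first exact: measurable_funPTI.
exact: etrans (esym (Q'E E mE)) Q'0.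
Qed.

End change_of_law.

Section KL_invariance.
Context {R : realType} {d d' : measure_display}
  {S : measurableType d} {S' : measurableType d'}.
Variables (P Q : probability S R) (P' Q' : probability S' R).
Variables (f : {mfun S >-> S'}) (g : {mfun S' >-> S}).
Hypothesis fK : cancel f g.
Hypothesis P'E : forall E, measurable E -> P' E = P (f @^-1` E).
Hypothesis Q'E : forall E, measurable E -> Q' E = Q (f @^-1` E).

(** Thanks to the measurable left inverse [g], every measurable set of [S] is the preimage under [f]
    of a measurable set: the image laws lose no information. *)
Let preimage_fK (E : set S) : f @^-1` (g @^-1` E) = E.
Proof. by rewrite -comp_preimage; apply/seteqP; split => x /=; rewrite fK. Qed.

(** A density is determined almost everywhere by its integrals over measurable sets, and both sides
    integrate to [P E] over each [E]. *)
Lemma Radon_Nikodym_image_law : P `<< Q -> P' `<< Q' ->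
  ae_eq Q setT (Radon_Nikodym (charge_of_finite_measure P) Q)
    (Radon_Nikodym (charge_of_finite_measure P') Q' \o f).
Proof.
move=> PQ PQ'.
have mR : measurable_fun setT (Radon_Nikodym (charge_of_finite_measure P') Q').
  by apply: measurable_int; exact: Radon_Nikodym_integrable.
apply: integral_ae_eq => //.
- exact: Radon_Nikodym_integrable.
- exact: measurableT_comp.
- move=> E _ mE; rewrite -Radon_Nikodym_integral//.
  (* Once [E] is written as a preimage under [f], the right-hand integral moves to [S'], where it
     equals the [P']-mass of the preimage of [E] under [g]. *)
  rewrite -{2}(preimage_fK E) -(integral_image_law _ _ Q'E)//; last first.
    exact: measurable_funPTI.
  rewrite -Radon_Nikodym_integral//; last exact: measurable_funPTI.
  by have := P'E _ (measurable_funPTI g mE); rewrite preimage_fK => /esym.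
Qed.

Lemma KL_image_law : KL P Q = KL P' Q'.
Proof.
have PE E : measurable E -> P E = P' (g @^-1` E).
  by move=> mE; rewrite P'E ?preimage_fK//; exact: measurable_funPTI.
have QE E : measurable E -> Q E = Q' (g @^-1` E).
  by move=> mE; rewrite Q'E ?preimage_fK//; exact: measurable_funPTI.
(* Domination passes forward along [f] and back along [g], so both divergences take the value [+oo]
   together. *)
rewrite /KL; case: asboolP => PQ; case: asboolP => PQ' //; last 2 first.
- by case: PQ'; exact: dominates_image_law P'E Q'E PQ.
- by case: PQ; exact: dominates_image_law PE QE PQ'.
have mln d0 (T : measurableType d0) (h : T -> \bar R) :
    measurable_fun setT h -> measurable_fun setT (fun x => (ln (fine (h x)))%:E).
  move=> mh; apply/measurable_EFinP; apply: (measurableT_comp (@measurable_ln R)).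
  exact: measurableT_comp.
have mR : measurable_fun setT (Radon_Nikodym (charge_of_finite_measure P) Q).
  by apply: measurable_int; exact: Radon_Nikodym_integrable.
have mR' : measurable_fun setT (Radon_Nikodym (charge_of_finite_measure P') Q').
  by apply: measurable_int; exact: Radon_Nikodym_integrable.
rewrite (integral_image_law _ _ P'E)//; last exact: mln.
rewrite preimage_setT; apply: ae_eq_integral => //.
- exact: mln.
- by apply: mln; exact: measurableT_comp.
(* The densities agree [Q]-almost everywhere, whereas the integral is against [P]; domination turns
   [Q]-null sets into [P]-null sets. *)
- apply: (null_dominates_ae_eq measurableT PQ).
  apply: filterS (Radon_Nikodym_image_law PQ PQ') => x /= h xT.
  by rewrite h.
Qed.

End KL_invariance.

HB.instance Definition _ (d1 d2 : measure_display)
    (A : measurableType d1) (B : measurableType d2) :=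
  isMeasurableFun.Build _ _ _ _ (@swap_pair A B) (@measurable_swap _ _ A B).

Lemma mutual_info_sym {R : realType} {d d1 d2 : measure_display}
    {Omega : measurableType d} {A : measurableType d1} {B : measurableType d2}
    (P : probability Omega R) (U : {mfun Omega >-> A}) (V : {mfun Omega >-> B}) :
  mutual_info P U V = mutual_info P V U.
Proof.
pose f : {mfun (A * B)%type >-> (B * A)%type} := @swap_pair A B.
pose g : {mfun (B * A)%type >-> (A * B)%type} := @swap_pair B A.
apply: (KL_image_law _ _ _ _ f g) => [[]//|//|E mE].
(* The joint laws correspond by computation. For the product laws it suffices to compare rectangles,
   which determine a product measure. *)
apply: (product_measure_unique
  (m' := pushforward (distribution P U \x distribution P V) f)) => // C D mC mD.
have fCD : f @^-1` (C `*` D) = D `*` C by apply/seteqP; split => -[a b] [].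
rewrite -[LHS]/((distribution P U \x distribution P V) (f @^-1` (C `*` D))) fCD.
by rewrite product_measure1E// muleC.
Qed.

(** If [a] or [b] is infinite then so is [a - b], which forces [s = +oo]; the convention
    [+oo - +oo = -oo] then makes [a - s] equal to [-oo]. *)
Lemma sub_abse_sub_le {R : realType} (a b s : \bar R) : `|a - b| <= s -> a - s <= b.
Proof.
case: a b s => [a||] [b||] [s||] //=; rewrite ?leey ?leNye //.
by rewrite -EFinB !lee_fin ler_norml lerBlDr -lerBlDl => /andP[].
Qed.

Theorem theorem1 (R : realType) (dX dF : measure_display)
    (X : measurableType dX) (F : measurableType dF)
    (D : probability F R -> probability F R -> \bar R)
    (ps pu : probability (X * bool)%type R)
    (Enc : set {mfun X >-> F}) (Gtheta : {mfun X >-> F}) :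
  divergence D ->
  0 < ps live_event -> 0 < pu live_event ->
  Enc Gtheta ->
  mutual_info pu (rep Gtheta) Ylive >=
    mutual_info ps (rep Gtheta) Y - Psi D ps pu Enc (Gamma D ps pu Gtheta).
Proof.
move=> _ _ _ EncG; rewrite (mutual_info_sym ps) (mutual_info_sym pu).
by apply: sub_abse_sub_le; apply: ereal_sup_ubound; exists Gtheta.
Qed.
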